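(* The set $\Omega_\theta=\{(w,b,v,u)\in\Omega_2:\mathcal O(w,v,u)\le\theta\}$ is bounded. Furthermore, the set of (global) solutions of problem (PP) is nonempty and bounded.
   Context: Setting. $[K]=\{1,\dots,K\}$; $\|\cdot\|$ is the Euclidean norm. $L,N,N_0,\dots,N_L$ are positive integers, $x_n\in\mathbb R^{N_0}$ and $y_n\in\mathbb R^{N_L}$ ($n\in[N]$) are given data, $Y=(y_1,\dots,y_N)$, and $0<\alpha<1$, $\lambda_w>0$, $\lambda_v>0$, $\beta_\ell>0$ ($\ell\in[L]$) are constants. $\sigma(z)=\max\{z,\alpha z\}$ componentwise. Variables. $W_\ell\in\mathbb R^{N_\ell\times N_{\ell-1}}$, $b_\ell\in\mathbb R^{N_\ell}$, $v_{n,\ell},u_{n,\ell}\in\mathbb R^{N_\ell}$ for $\ell\in[L]$, $n\in[N]$, with $v_{n,0}:=x_n$. Put $\widetilde N=\sum_{\ell=1}^LN_\ell N_{\ell-1}$, $\overline N=\sum_{\ell=1}^LN_\ell$, $m=N\overline N$. The vectors $w\in\mathbb R^{\widetilde N}$ (stacking the column-wise vectorizations of $W_1,\dots,W_L$), $b\in\mathbb R^{\overline N}$ (stacking $b_1,\dots,b_L$), and $v,u\in\mathbb R^m$ (stacking $v_{n,\ell}$, resp. $u_{n,\ell}$, in the order $(1,1),(2,1),\dots,(N,1),(1,2),\dots,(N,L)$ of $(n,\ell)$) collect the variables. The linear-in-$w$ map $\Psi(v)w$ and the matrix $A\in\mathbb R^{m\times\overline N}$ are such that $\Psi(v)w+Ab$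 has $(n,\ell)$ block $W_\ell v_{n,\ell-1}+b_\ell$; that is, $\Psi(v)$ is block diagonal with blocks $V_{\ell-1}^\top\otimes I_{N_\ell}$, where $V_\ell=(v_{1,\ell},\dots,v_{N,\ell})$, $V_0=(x_1,\dots,x_N)$, and $A$ is block diagonal with blocks $e_N\otimes I_{N_\ell}$ ($e_K$ is the all-ones vector in $\mathbb R^K$). Objective. $\mathcal R_1(w)=\lambda_w\sum_{\ell=1}^L\sum_{j=1}^{N_{\ell-1}}\|(W_\ell)_{\cdot,j}\|$ (with $(W_\ell)_{\cdot,j}$ the $j$-th column), $\mathcal R_2(v)=\lambda_v\|v\|^2$, $\bar{\mathcal O}(w,v)=\frac1N\sum_{n=1}^N\|v_{n,L}-y_n\|^2+\mathcal R_1(w)+\mathcal R_2(v)$. With $\beta=(\beta_1e_{NN_1}^\top,\dots,\beta_Le_{NN_L}^\top)^\top\in\mathbb R^m$, $\mathcal O(w,v,u)=\bar{\mathcal O}(w,v)+\beta^\top(v-\sigma(u))$. Problem (PP): minimize $\mathcal O(w,v,u)$ over $\Omega_2=\{(w,b,v,u): v-u\ge0,\ v-\alpha u\ge 0,\ u=\Psi(v)w+Ab\}$. The number $\theta$ is fixed with $\theta>\frac1N\|Y\|_F^2$. *)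

(* Defs.v *)
From HB Require Import structures.
From mathcomp Require Import all_boot all_order all_algebra.
From mathcomp Require Import mxtens.
From mathcomp Require Import all_classical all_reals all_analysis.

Set Implicit Arguments.
Unset Strict Implicit.
Unset Printing Implicit Defensive.

Import numFieldNormedType.Exports.
Import Order.TTheory GRing.Theory Num.Theory.
Local Open Scope classical_set_scope.
Local Open Scope ring_scope.

(* Conventions.  [Nd l] is the width $N_l$ of layer l, 0 <= l <= L.  The layer
   l in {1, ..., L} is indexed by the ordinal of value l - 1, so that under
   [l : 'I_L] the widths $N_l$ and $N_{l-1}$ are [Nd l.+1] and [Nd l].  The
   training data are the columns of [X : 'M_(Nd 0, N)] and [Y : 'M_(Nd L, N)].

   The factors of [dim_w] are in this order because the column-wise
   vectorization of W : 'M_(p, q) is the row-major vectorization of W^T. *)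
Notation dim_w L Nd := (\sum_(l < L) (Nd l * Nd l.+1))%N.
Notation dim_b L Nd := (\sum_(l < L) Nd l.+1)%N.
Notation dim_v L N Nd := (\sum_(l < L) (N * Nd l.+1))%N.

Notation vars R L N Nd :=
  ('cV[R]_(dim_w L Nd) * 'cV[R]_(dim_b L Nd) *
   'cV[R]_(dim_v L N Nd) * 'cV[R]_(dim_v L N Nd))%type.

(* The Frobenius norm; on column vectors, the Euclidean norm. *)
Definition fnorm (R : realType) (p q : nat) (A : 'M[R]_(p, q)) : R :=
  Num.sqrt (\sum_(i < p) \sum_(j < q) A i j ^+ 2).

(* Inverse of the column-wise vectorization: column j of [unvec z] is the j-th
   of the q successive blocks of size p of z. *)
Definition unvec (R : realType) (p q : nat) (z : 'cV[R]_(q * p)) : 'M[R]_(p, q) :=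
  (vec_mx z^T)^T.

(* Analogue of [mxdiag] for rectangular diagonal blocks. *)
Definition mxdiag_rect (R : realType) (k : nat) (p q : 'I_k -> nat)
    (B : forall i, 'M[R]_(p i, q i)) : 'M[R]_(\sum_i p i, \sum_i q i) :=
  \mxblock_(i < k, j < k) (if i == j then conform_mx 0 (B i) else 0).

Definition weight (R : realType) (L : nat) (Nd : nat -> nat)
    (w : 'cV[R]_(dim_w L Nd)) (l : 'I_L) : 'M[R]_(Nd l.+1, Nd l) :=
  unvec (submxcol w l).

(* The matrix $V_l = (v_{1,l}, ..., v_{N,l})$, with $V_0 = X$; the value for
   l > L is irrelevant. *)
Definition state (R : realType) (L N : nat) (Nd : nat -> nat)
    (X : 'M[R]_(Nd 0%N, N)) (v : 'cV[R]_(dim_v L N Nd)) (l : nat) :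
    'M[R]_(Nd l, N) :=
  match l return 'M[R]_(Nd l, N) with
  | 0%N => X
  | k.+1 => match decP (@idP (k < L)%N) with
            | left ltkL => unvec (submxcol v (Ordinal ltkL))
            | right _ => 0
            end
  end.

Definition Psi (R : realType) (L N : nat) (Nd : nat -> nat)
    (X : 'M[R]_(Nd 0%N, N)) (v : 'cV[R]_(dim_v L N Nd)) :
    'M[R]_(dim_v L N Nd, dim_w L Nd) :=
  mxdiag_rect (fun l : 'I_L => (state X v l)^T *t (1%:M : 'M[R]_(Nd l.+1))).

Definition Amat (R : realType) (L N : nat) (Nd : nat -> nat) :
    'M[R]_(dim_v L N Nd, dim_b L Nd) :=
  mxdiag_rect (fun l : 'I_L => castmx (erefl, mul1n (Nd l.+1))
    ((const_mx 1 : 'cV[R]_N) *t (1%:M : 'M[R]_(Nd l.+1)))).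

Definition beta_vec (R : realType) (L N : nat) (Nd : nat -> nat)
    (beta : 'I_L -> R) : 'cV[R]_(dim_v L N Nd) :=
  \mxcol_(l < L) const_mx (beta l).

Definition sigma (R : realType) (alpha : R) (p : nat) (z : 'cV[R]_p) : 'cV[R]_p :=
  map_mx (fun t => Num.max t (alpha * t)) z.

Definition R1 (R : realType) (L : nat) (Nd : nat -> nat) (lambda_w : R)
    (w : 'cV[R]_(dim_w L Nd)) : R :=
  lambda_w * \sum_(l < L) \sum_(j < Nd l) fnorm (col j (weight w l)).

Definition R2 (R : realType) (p : nat) (lambda_v : R) (v : 'cV[R]_p) : R :=
  lambda_v * fnorm v ^+ 2.

Definition obj_bar (R : realType) (L N : nat) (Nd : nat -> nat)
    (X : 'M[R]_(Nd 0%N, N)) (Y : 'M[R]_(Nd L, N)) (lambda_w lambda_v : R)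
    (w : 'cV[R]_(dim_w L Nd)) (v : 'cV[R]_(dim_v L N Nd)) : R :=
  N%:R^-1 * \sum_(n < N) fnorm (col n (state X v L) - col n Y) ^+ 2
  + R1 lambda_w w + R2 lambda_v v.

Definition obj (R : realType) (L N : nat) (Nd : nat -> nat)
    (X : 'M[R]_(Nd 0%N, N)) (Y : 'M[R]_(Nd L, N)) (alpha lambda_w lambda_v : R)
    (beta : 'I_L -> R)
    (w : 'cV[R]_(dim_w L Nd)) (v u : 'cV[R]_(dim_v L N Nd)) : R :=
  obj_bar X Y lambda_w lambda_v w v
  + ((beta_vec N Nd beta)^T *m (v - sigma alpha u)) 0 0.

Definition Omega2 (R : realType) (L N : nat) (Nd : nat -> nat)
    (X : 'M[R]_(Nd 0%N, N)) (alpha : R) : set (vars R L N Nd) :=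
  [set z : vars R L N Nd | let: (w, b, v, u) := z in
    [/\ forall i, 0 <= (v - u) i 0,
        forall i, 0 <= (v - alpha *: u) i 0
      & u = Psi X v *m w + Amat R L N Nd *m b]].

Definition Omega_theta (R : realType) (L N : nat) (Nd : nat -> nat)
    (X : 'M[R]_(Nd 0%N, N)) (Y : 'M[R]_(Nd L, N)) (alpha lambda_w lambda_v : R)
    (beta : 'I_L -> R) (theta : R) : set (vars R L N Nd) :=
  [set z : vars R L N Nd | Omega2 X alpha z /\
    let: (w, _, v, u) := z in
    obj X Y alpha lambda_w lambda_v beta w v u <= theta].

Definition PP_solutions (R : realType) (L N : nat) (Nd : nat -> nat)
    (X : 'M[R]_(Nd 0%N, N)) (Y : 'M[R]_(Nd L, N)) (alpha lambda_w lambda_v : R)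
    (beta : 'I_L -> R) : set (vars R L N Nd) :=
  [set z : vars R L N Nd | Omega2 X alpha z /\
    forall z', Omega2 X alpha z' ->
      let: (w, _, v, u) := z in
      let: (w', _, v', u') := z' in
      obj X Y alpha lambda_w lambda_v beta w v u
        <= obj X Y alpha lambda_w lambda_v beta w' v' u'].

(* Main.v *)
Require Import Defs.
From HB Require Import structures.
From mathcomp Require Import all_boot all_order all_algebra.
From mathcomp Require Import mxtens lra.
From mathcomp Require Import all_classical all_reals all_analysis.
Import numFieldNormedType.Exports.
Import Order.TTheory GRing.Theory Num.Theory.
Local Open Scope classical_set_scope.
Local Open Scope ring_scope.

Set Implicit Arguments.
Unset Strict Implicit.
Unset Printing Implicit Defensive.

(** The sublevel set [Omega_theta] is closed, because it is cut out of a
    finite-dimensional space by equations and weak inequalities between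
    continuous functions.  The point of the theorem is that it is bounded; it is
    then compact.  As it contains the zero network, whose objective value is
    $\frac1N\|Y\|_F^2 < \theta$, the continuous objective attains its minimum on
    it, and a minimizer over the sublevel set is a minimizer over the whole
    feasible set.  Every solution does at least as well as the zero network, so
    the solutions lie in [Omega_theta] and are bounded too.

    Boundedness.  On the feasible set $v \ge \max(u, \alpha u) = \sigma(u)$, so
    the penalty $\beta^\top(v - \sigma(u))$ is a sum of nonnegative terms, and
    $\mathcal O \le \theta$ bounds the loss, both regularizers and the penalty
    separately ([Omega_theta_terms]).
    - The group norm $\mathcal R_1$ controls $w$ ([bounded_w]), and
      $\mathcal R_2$ controls $v$ ([bounded_v]).
    - The auxiliary variable $u$ has no regularizer.  It is bounded above by
      $v$; below, the penalty keeps $\sigma(u)$ close to $v$, and the leaky ReLU is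
      coercive because $\alpha > 0$ ([leaky_preimage_bound], [bounded_u]).  With
      the plain ReLU, $\alpha = 0$, this step would fail.
    - The bias $b$ appears in neither the objective nor the inequalities.  The
      equation $Ab = u - \Psi(v)w$ bounds $Ab$, and every coordinate of $b$ is
      also a coordinate of $Ab$ as soon as there is one data point
      ([mul_Amat_entry], [bounded_b]). *)

(** * Entries, max norm and Frobenius norm of a matrix *)

Section MatrixNorms.
Context {R : realType}.
Implicit Types p q : nat.

Lemma mx_norm_leP p q (A : 'M[R]_(p, q)) (M : R) :
  0 <= M -> (forall i j, `|A i j| <= M) -> `|A| <= M.
Proof.
move=> M0 AM; rewrite [leLHS]/Num.Def.normr/= mx_normrE bigmax_le// => i _.
Qed.

Lemma coord_le_mx_norm p q (A : 'M[R]_(p, q)) i j : `|A i j| <= `|A|.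
Proof.
rewrite [leRHS]/Num.Def.normr/= mx_normrE.
exact: (@le_bigmax _ _ _ 0 (fun ij : 'I_p * 'I_q => `|A ij.1 ij.2|) (i, j)).
Qed.

Lemma fnorm_ge0 p q (A : 'M[R]_(p, q)) : 0 <= fnorm A.
Proof. exact: sqrtr_ge0. Qed.

Lemma sqr_fnorm p q (A : 'M[R]_(p, q)) :
  fnorm A ^+ 2 = \sum_(i < p) \sum_(j < q) A i j ^+ 2.
Proof.
rewrite sqr_sqrtr//; apply: sumr_ge0 => i _; apply: sumr_ge0 => j _.
exact: sqr_ge0.
Qed.

Lemma sqr_fnorm_col p q (A : 'M[R]_(p, q)) :
  \sum_(j < q) fnorm (col j A) ^+ 2 = fnorm A ^+ 2.
Proof.
rewrite sqr_fnorm exchange_big/=; apply: eq_bigr => j _.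
by rewrite sqr_fnorm; apply: eq_bigr => i _; rewrite big_ord1 mxE.
Qed.

Lemma fnorm0 p q : fnorm (0 : 'M[R]_(p, q)) = 0.
Proof.
rewrite /fnorm big1 ?sqrtr0// => i _; rewrite big1// => j _.
by rewrite mxE expr0n.
Qed.

Lemma fnormN p q (A : 'M[R]_(p, q)) : fnorm (- A) = fnorm A.
Proof.
congr Num.sqrt; apply: eq_bigr => i _; apply: eq_bigr => j _.
by rewrite mxE sqrrN.
Qed.

Lemma coord_le_fnorm p q (A : 'M[R]_(p, q)) i j : `|A i j| <= fnorm A.
Proof.
rewrite -sqrtr_sqr ler_wsqrtr// (bigD1 i)//= (bigD1 j)//= -addrA lerDl.
rewrite addr_ge0// sumr_ge0// => k _; first exact: sqr_ge0.
by apply: sumr_ge0 => l _; exact: sqr_ge0.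
Qed.

End MatrixNorms.

(** * Continuity of matrix-valued maps *)

Section Continuity.
Context {R : realType} {T : topologicalType}.

(** The matrix topology is that of entrywise convergence; reducing to entries is
    how every matrix operation below is shown to be continuous. *)
Lemma continuous_mx p q (f : T -> 'M[R]_(p, q)) :
  (forall i j, continuous (fun t => f t i j)) -> continuous f.
Proof.
move=> fc t; apply/cvgrPdist_le => e e0.
near=> s; apply: mx_norm_leP; first exact: ltW.
move=> i j; rewrite !mxE; move: i j; near: s.
apply: filter_forall => i; apply: filter_forall => j.
by move: e e0; apply/cvgrPdist_le; exact: fc.
Unshelve. all: by end_near. Qed.

Lemma continuous_entry p q (f : T -> 'M[R]_(p, q)) i j :
  continuous f -> continuous (fun t => f t i j).
Proof.
move=> fc t; apply: (@continuous_comp _ _ _ f (fun M => M i j)).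
  exact: fc.
exact: coord_continuous.
Qed.

Lemma continuous_addr (f g : T -> R) :
  continuous f -> continuous g -> continuous (fun t => f t + g t).
Proof. by move=> fc gc t; apply: (continuousD (fc t) (gc t)). Qed.

Lemma continuous_subr (f g : T -> R) :
  continuous f -> continuous g -> continuous (fun t => f t - g t).
Proof. by move=> fc gc t; apply: (continuousB (fc t) (gc t)). Qed.

Lemma continuous_mulr (f g : T -> R) :
  continuous f -> continuous g -> continuous (fun t => f t * g t).
Proof. by move=> fc gc t; apply: (continuousM (fc t) (gc t)). Qed.

Lemma continuous_maxr (f g : T -> R) :
  continuous f -> continuous g -> continuous (fun t => Num.max (f t) (g t)).
Proof. by move=> fc gc t; apply: (continuous_max (fc t) (gc t)). Qed.

Lemma continuous_sumr (I : Type) (r : seq I) (P : pred I) (F : I -> T -> R) :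
  (forall i, P i -> continuous (F i)) ->
  continuous (fun t => \sum_(i <- r | P i) F i t).
Proof. by apply: continuous_big; exact: add_continuous. Qed.

Lemma continuous_addmx p q (f g : T -> 'M[R]_(p, q)) :
  continuous f -> continuous g -> continuous (fun t => f t + g t).
Proof. by move=> fc gc t; apply: (continuousD (fc t) (gc t)). Qed.

Lemma continuous_fst (U V : topologicalType) (f : T -> U * V) :
  continuous f -> continuous (fun t => (f t).1).
Proof. by move=> fc t; apply: cvg_comp (fc t) _; exact: cvg_fst. Qed.

Lemma continuous_snd (U V : topologicalType) (f : T -> U * V) :
  continuous f -> continuous (fun t => (f t).2).
Proof. by move=> fc t; apply: cvg_comp (fc t) _; exact: cvg_snd. Qed.

Lemma continuous_mulmx p q r (f : T -> 'M[R]_(p, q)) (g : T -> 'M[R]_(q, r)) :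
  continuous f -> continuous g -> continuous (fun t => f t *m g t).
Proof.
move=> fc gc; apply: continuous_mx => i j; under eq_fun do rewrite mxE.
apply: continuous_sumr => k _.
by apply: continuous_mulr; exact: continuous_entry.
Qed.

Lemma continuous_fnorm p q (f : T -> 'M[R]_(p, q)) :
  continuous f -> continuous (fun t => fnorm (f t)).
Proof.
move=> fc t.
apply: (@continuous_comp _ _ _ _ Num.sqrt); last exact: sqrt_continuous.
move: t; do 2![apply: continuous_sumr => ? _].
by apply: continuous_mulr; exact: continuous_entry.
Qed.

Lemma continuous_sqr_fnorm p q (f : T -> 'M[R]_(p, q)) :
  continuous f -> continuous (fun t => fnorm (f t) ^+ 2).
Proof.
move=> fc; under eq_fun do rewrite expr2.
by apply: continuous_mulr; exact: continuous_fnorm.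
Qed.

Lemma closed_le_fun (f g : T -> R) :
  continuous f -> continuous g -> closed [set t | f t <= g t].
Proof.
move=> fc gc.
have -> : [set t | f t <= g t] = (fun t => g t - f t) @^-1` [set x | 0 <= x].
  by apply/seteqP; split => t /=; rewrite subr_ge0.
apply: preimage_closed; last exact: closed_ge.
by move=> t _; exact: continuous_subr.
Qed.

Lemma closed_forall (I : Type) (P : I -> T -> Prop) :
  (forall i, closed [set t | P i t]) -> closed [set t | forall i, P i t].
Proof.
move=> Pc; have -> : [set t | forall i, P i t] = \bigcap_i [set t | P i t].
  by apply/seteqP; split => t /= h; [move=> i _; exact: h|move=> i; exact: h].
exact: closed_bigI.
Qed.

End Continuity.

(** * Boundedness and compactness in finite dimension *)

Section BoundedFamilies.
Context {R : realType}.

(** [ex_bound] gives this for nonempty [A] only, as the principal filter on the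
    empty set is not proper. *)
Lemma bounded_setP (V : normedModType R) (A : set V) :
  bounded_set A <-> exists M, forall x, A x -> `|x| <= M.
Proof.
split=> [/pinfty_ex_gt0[M _ AM]|[M AM]]; first by exists M.
by exists M; split=> [|r /ltW Mr x /AM /le_trans]; [exact: num_real|exact].
Qed.

(** There are finitely many coordinates, so coordinatewise bounds with unrelated
    constants suffice; the sum of their absolute values is a common one. *)
Lemma bounded_cV (T : Type) (A : set T) p (f : T -> 'cV[R]_p) :
  (forall i, exists M, forall z, A z -> `|f z i 0| <= M) ->
  exists M, forall z, A z -> `|f z| <= M.
Proof.
move=> /choice[M fM]; exists (\sum_i `|M i|) => z Az.
apply: mx_norm_leP => [|i j]; first by rewrite sumr_ge0.
rewrite ord1 (le_trans (fM i z Az))// (le_trans (ler_norm _))//.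
by rewrite (bigD1 i)//= lerDl sumr_ge0.
Qed.

(** The Heine-Borel property, phrased for balls because a ball of a product of
    normed modules is a product of balls, to which [compact_setX] applies. *)
Definition proper_space (V : normedModType R) :=
  forall r : R, compact [set x : V | `|x| <= r].

Lemma bounded_closed_compact_proper (V : normedModType R) (A : set V) :
  proper_space V -> bounded_set A -> closed A -> compact A.
Proof.
move=> Vp /bounded_setP[M AM] Acl.
exact: subclosed_compact Acl (Vp M) _.
Qed.

(** A ball of the max norm is a cube.  Cubes of row vectors are compact by
    [rV_compact], and transposition carries them to cubes of column vectors. *)
Lemma proper_cV p : proper_space 'cV[R]_p.
Proof.
move=> r; have trc : continuous (fun x : 'rV[R]_p => x^T).
  apply: continuous_mx => i j; under eq_fun do rewrite mxE.
  exact: coord_continuous.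
have cube : compact [set x : 'rV[R]_p | forall i, `[- r, r]%classic (x 0 i)].
  apply: (@rV_compact _ _ (fun=> `[- r, r]%classic)) => _.
  exact: segment_compact.
have cubeT := continuous_compact (continuous_subspaceT trc) cube.
apply: (subclosed_compact _ cubeT) => [|x /= xr].
  by apply: closed_le_fun => t; [exact: norm_continuous|exact: cst_continuous].
exists x^T; last exact: trmxK.
move=> i /=; rewrite in_itv/= -ler_norml mxE.
by rewrite (le_trans (coord_le_mx_norm _ _ _)).
Qed.

Lemma proper_prod (V W : normedModType R) :
  proper_space V -> proper_space W -> proper_space (V * W)%type.
Proof.
move=> Vp Wp r.
have -> : [set x : V * W | `|x| <= r] =
    [set x | `|x| <= r] `*` [set x | `|x| <= r].
  by apply/seteqP; split => -[x y] /=; rewrite prod_normE/= ge_max => /andP.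
exact: compact_setX.
Qed.

End BoundedFamilies.


(** * Block products *)

Section BlockDiagonal.
Context {R : realType}.

Lemma mul_mxdiag_rect k (p q : 'I_k -> nat) (B : forall i, 'M[R]_(p i, q i)) m
    (z : 'M[R]_(\sum_i q i, m)) :
  mxdiag_rect B *m z = \mxcol_i (B i *m submxcol z i).
Proof.
rewrite -[z in LHS]submxcolK mul_mxblock_mxrow; apply/eq_mxcol => i.
rewrite (bigD1 i)//= eqxx conform_mx_id big1 ?addr0// => j /negPf ji.
by rewrite eq_sym ji mul0mx.
Qed.

Lemma mul_PsiE L N (Nd : nat -> nat) (X : 'M[R]_(Nd 0%N, N))
    (v : 'cV[R]_(dim_v L N Nd)) (w : 'cV[R]_(dim_w L Nd)) :
  Psi X v *m w =
  \mxcol_(l < L) (((state X v l)^T *t 1%:M) *m submxcol w l).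
Proof. exact: mul_mxdiag_rect. Qed.

(** $e_n \otimes I_m$ stacks $n$ copies of the identity. *)
Lemma tens_const1_entry n m (i : 'I_n) (k j : 'I_m) :
  castmx (erefl, mul1n m) ((const_mx 1 : 'cV[R]_n) *t (1%:M : 'M[R]_m))
    (mxtens_index (i, k)) j = (k == j)%:R.
Proof.
rewrite castmxE !mxE mul1r cast_ord_id mxtens_indexK/=.
by congr (_ == _)%:R; apply: val_inj; rewrite /= modn_small.
Qed.

(** The bias of a layer is added to the state of every data point, so each block
    of $Ab$ that belongs to one data point is a copy of the bias: $A$ is
    injective once $N > 0$, with a bounded inverse in the max norm. *)
Lemma mul_Amat_entry L N (Nd : nat -> nat) (b : 'cV[R]_(dim_b L Nd)) (l : 'I_L)
    (n : 'I_N) (k : 'I_(Nd l.+1)) :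
  submxcol (Amat R L N Nd *m b) l (mxtens_index (n, k)) 0 = submxcol b l k 0.
Proof.
rewrite mul_mxdiag_rect mxcolK mxE (bigD1 k)//= tens_const1_entry eqxx mul1r.
rewrite big1 ?addr0// => j /negPf jk.
by rewrite tens_const1_entry eq_sym jk mul0r.
Qed.

End BlockDiagonal.

(** * Continuity of the objective and of the constraints *)

Section NetworkContinuity.
Context {R : realType} {T : topologicalType} {L N : nat} {Nd : nat -> nat}.

Lemma continuous_submxcol k (p : 'I_k -> nat) m
    (f : T -> 'M[R]_(\sum_i p i, m)) i :
  continuous f -> continuous (fun t => submxcol (f t) i).
Proof.
move=> fc; apply: continuous_mx => a b; under eq_fun do rewrite mxE.
exact: continuous_entry.
Qed.

Lemma continuous_unvec p q (f : T -> 'cV[R]_(q * p)) :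
  continuous f -> continuous (fun t => unvec (f t)).
Proof.
move=> fc; apply: continuous_mx => a b; under eq_fun do rewrite !mxE.
exact: continuous_entry.
Qed.

Lemma continuous_state (X : 'M[R]_(Nd 0%N, N))
    (v : T -> 'cV[R]_(dim_v L N Nd)) l :
  continuous v -> continuous (fun t => state X (v t) l).
Proof.
case: l => [|k] vc /=; first by move=> t; exact: cst_continuous.
case: decP => [kL|_]; last by move=> t; exact: cst_continuous.
by apply: continuous_unvec; exact: continuous_submxcol.
Qed.

(** Blockwise the product is $(V_{l-1}^\top \otimes I)\,w_l$, a polynomial in
    the coordinates of $v$ and $w$. *)
Lemma continuous_mul_Psi (X : 'M[R]_(Nd 0%N, N))
    (v : T -> 'cV[R]_(dim_v L N Nd)) (w : T -> 'cV[R]_(dim_w L Nd)) :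
  continuous v -> continuous w -> continuous (fun t => Psi X (v t) *m w t).
Proof.
move=> vc wc.
rewrite [X in continuous X](funext (fun t => mul_PsiE X (v t) (w t))).
apply: continuous_mx => i j; under eq_fun do rewrite mxE.
apply: continuous_entry; apply: continuous_mulmx; last first.
  exact: continuous_submxcol.
apply: continuous_mx => a b; under eq_fun do rewrite !mxE.
apply: continuous_mulr => [|t]; last exact: cst_continuous.
by apply: continuous_entry; exact: continuous_state.
Qed.

Lemma continuous_R1 lambda_w (w : T -> 'cV[R]_(dim_w L Nd)) :
  continuous w -> continuous (fun t => R1 lambda_w (w t)).
Proof.
move=> wc; apply: continuous_mulr => [t|]; first exact: cst_continuous.
do 2![apply: continuous_sumr => ? _].
apply: continuous_fnorm; apply: continuous_mx => a b.
under eq_fun do rewrite mxE.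
by apply: continuous_entry; apply: continuous_unvec; exact: continuous_submxcol.
Qed.

Lemma continuous_obj (X : 'M[R]_(Nd 0%N, N)) (Y : 'M[R]_(Nd L, N))
    (alpha lambda_w lambda_v : R) (beta : 'I_L -> R)
    (w : T -> 'cV[R]_(dim_w L Nd)) (v u : T -> 'cV[R]_(dim_v L N Nd)) :
  continuous w -> continuous v -> continuous u ->
  continuous (fun t => obj X Y alpha lambda_w lambda_v beta (w t) (v t) (u t)).
Proof.
move=> wc vc uc.
apply: continuous_addr; first apply: continuous_addr;
  first apply: continuous_addr.
- apply: continuous_mulr => [t|]; first exact: cst_continuous.
  apply: continuous_sumr => n _; apply: continuous_sqr_fnorm.
  apply: continuous_mx => i j; under eq_fun do rewrite !mxE.
  apply: continuous_subr => [|t]; last exact: cst_continuous.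
  by apply: continuous_entry; exact: continuous_state.
- exact: continuous_R1.
- apply: continuous_mulr => [t|]; first exact: cst_continuous.
  exact: continuous_sqr_fnorm.
- apply: continuous_entry; apply: continuous_mulmx => [t|].
    exact: cst_continuous.
  apply: continuous_mx => i j; under eq_fun do rewrite !mxE.
  apply: continuous_subr; first exact: continuous_entry.
  apply: continuous_maxr; first exact: continuous_entry.
  apply: continuous_mulr => [t|]; first exact: cst_continuous.
  exact: continuous_entry.
Qed.

End NetworkContinuity.

Section CoordinateProjections.
Context (R : realType) (L N : nat) (Nd : nat -> nat).

Lemma continuous_w : continuous (fun z : vars R L N Nd => z.1.1.1).
Proof. by do 3!apply: continuous_fst; move=> z; exact: cvg_id. Qed.

Lemma continuous_b : continuous (fun z : vars R L N Nd => z.1.1.2).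
Proof.
by apply: continuous_snd; do 2!apply: continuous_fst; move=> z; exact: cvg_id.
Qed.

Lemma continuous_v : continuous (fun z : vars R L N Nd => z.1.2).
Proof.
by apply: continuous_snd; apply: continuous_fst => z; exact: cvg_id.
Qed.

Lemma continuous_u : continuous (fun z : vars R L N Nd => z.2).
Proof. by apply: continuous_snd => z; exact: cvg_id. Qed.

End CoordinateProjections.

(** * Bounds on a sublevel set of the objective *)

Section SublevelBounds.
Context {R : realType} {L N : nat} {Nd : nat -> nat}.
Context {X : 'M[R]_(Nd 0%N, N)} {Y : 'M[R]_(Nd L, N)}.
Context {alpha lambda_w lambda_v theta : R} {beta : 'I_L -> R}.
Hypotheses (N_gt0 : (0 < N)%N) (alpha_gt0 : 0 < alpha) (alpha_lt1 : alpha < 1).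
Hypotheses (lambda_w_gt0 : 0 < lambda_w) (lambda_v_gt0 : 0 < lambda_v).
Hypothesis beta_gt0 : forall l : 'I_L, 0 < beta l.

Local Notation Feasible := (@Omega2 R L N Nd X alpha).
Local Notation OmegaT := (Omega_theta X Y alpha lambda_w lambda_v beta theta).
Local Notation penalty v u :=
  (((beta_vec N Nd beta)^T *m (v - sigma alpha u)) 0 0).

Lemma penaltyE v u : penalty v u =
  \sum_i beta (tagnat.sig1 i) * (v i 0 - Num.max (u i 0) (alpha * u i 0)).
Proof. by rewrite mxE; apply: eq_bigr => i _; rewrite !mxE. Qed.

Lemma Omega2_feasible w b v u : Feasible (w, b, v, u) ->
  forall i, u i 0 <= v i 0 /\ alpha * u i 0 <= v i 0.
Proof.
by case=> vu vau _ i; move: (vu i) (vau i); rewrite !mxE !subr_ge0.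
Qed.

Lemma penalty_term_ge0 w b v u i : Feasible (w, b, v, u) ->
  0 <= beta (tagnat.sig1 i) * (v i 0 - Num.max (u i 0) (alpha * u i 0)).
Proof.
move=> /Omega2_feasible/(_ i)[uv auv].
by apply: mulr_ge0; [exact: ltW|rewrite subr_ge0 ge_max uv auv].
Qed.

Lemma R1_ge0 (w : 'cV[R]_(dim_w L Nd)) : 0 <= R1 lambda_w w.
Proof.
apply: mulr_ge0; [exact: ltW|apply: sumr_ge0 => l _]; apply: sumr_ge0 => j _.
exact: fnorm_ge0.
Qed.

Lemma R2_ge0 p (v : 'cV[R]_p) : 0 <= R2 lambda_v v.
Proof. by apply: mulr_ge0; [exact: ltW|exact: sqr_ge0]. Qed.

(** The loss, the two regularizers and, by feasibility, the penalty are all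
    nonnegative, so each is at most their sum. *)
Lemma Omega_theta_terms w b v u : OmegaT (w, b, v, u) ->
  [/\ R1 lambda_w w <= theta, R2 lambda_v v <= theta & penalty v u <= theta].
Proof.
case=> z2; rewrite /obj /obj_bar => le_theta.
have loss_ge0 : 0 <= N%:R^-1 *
    \sum_(n < N) fnorm (col n (state X v L) - col n Y) ^+ 2.
  by rewrite mulr_ge0 ?invr_ge0// sumr_ge0// => n _; exact: sqr_ge0.
have pen_ge0 : 0 <= penalty v u.
  by rewrite penaltyE sumr_ge0// => i _; exact: penalty_term_ge0 z2.
have := R1_ge0 w; have := R2_ge0 v.
by split; lra.
Qed.

(** The weight matrices rearrange the coordinates of $w$ without losing any. *)
Lemma weight_entry (w : 'cV[R]_(dim_w L Nd)) i :
  exists a c, w i 0 = weight w (tagnat.sig1 i) a c.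
Proof.
have : w i 0 = submxcol w (tagnat.sig1 i) (tagnat.sig2 i) 0.
  by rewrite mxE tagnat.sig2K.
case/mxvec_indexP: (tagnat.sig2 i) => c a ->; exists a, c.
by rewrite !mxE.
Qed.

Lemma bounded_w : exists M, forall z, OmegaT z -> `|z.1.1.1| <= M.
Proof.
apply: bounded_cV => i; exists (theta / lambda_w) => -[[[w b] v] u]/=.
move=> /Omega_theta_terms[R1_le _ _].
have [a [c ->]] := weight_entry w i.
rewrite ler_pdivlMr// mulrC (le_trans _ R1_le)// ler_pM2l//.
rewrite (bigD1 (tagnat.sig1 i))//= (bigD1 c)//= -addrA.
have := coord_le_fnorm (col c (weight w (tagnat.sig1 i))) a 0; rewrite mxE.
move=> /le_trans; apply; rewrite lerDl addr_ge0// sumr_ge0// => j _.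
  exact: fnorm_ge0.
by apply: sumr_ge0 => k _; exact: fnorm_ge0.
Qed.

Lemma bounded_v : exists M, forall z, OmegaT z -> `|z.1.2| <= M.
Proof.
exists (Num.sqrt (theta / lambda_v)) => -[[[w b] v] u]/=.
move=> /Omega_theta_terms[_ R2_le _].
apply: mx_norm_leP => [|i j]; first exact: sqrtr_ge0.
rewrite (le_trans (coord_le_fnorm v i j))//.
rewrite -[fnorm v]ger0_norm ?fnorm_ge0// -sqrtr_sqr ler_wsqrtr//.
by rewrite ler_pdivlMr// mulrC.
Qed.

(** Coercivity of the leaky ReLU.  For $s \ge 0$ the hypothesis
    $\alpha s \le t$ suffices; for $s < 0$ the maximum is $\alpha s$, so that
    $\alpha |s| \le c - t$. *)
Lemma leaky_preimage_bound (s t c : R) : s <= t -> alpha * s <= t ->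
  t - Num.max s (alpha * s) <= c -> `|s| <= (`|t| + c) / alpha.
Proof.
move=> st ast tc; rewrite ler_pdivlMr//.
have c_ge0 : 0 <= c by apply: le_trans tc; rewrite subr_ge0 ge_max st ast.
have tt := ler_norm t; have [s_ge0|s_lt0] := lerP 0 s.
  by rewrite ger0_norm//; lra.
have s_le : s <= alpha * s.
  have : 0 <= (alpha - 1) * s by rewrite mulr_le0 ?subr_le0 ?ltW.
  by lra.
rewrite ltr0_norm//; move: tc; rewrite max_r//.
by have := ler_norm (- t); rewrite normrN; lra.
Qed.

Lemma bounded_u : exists M, forall z, OmegaT z -> `|z.2| <= M.
Proof.
have [Mv vM] := bounded_v.
apply: bounded_cV => i.
exists ((Mv + theta / beta (tagnat.sig1 i)) / alpha).
move=> -[[[w b] v] u] zT /=; have [z2 _] := zT.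
have [uv auv] := Omega2_feasible z2 i.
have pen_i : v i 0 - Num.max (u i 0) (alpha * u i 0)
    <= theta / beta (tagnat.sig1 i).
  have [_ _] := Omega_theta_terms zT; rewrite penaltyE (bigD1 i)//= => le_theta.
  rewrite ler_pdivlMr// mulrC (le_trans _ le_theta)// lerDl sumr_ge0// => j _.
  exact: penalty_term_ge0 z2.
apply: le_trans (leaky_preimage_bound uv auv pen_i) _.
rewrite ler_pM2r ?invr_gt0// lerD2r (le_trans (coord_le_mx_norm _ _ _))//.
exact: vM zT.
Qed.

(** Continuity of $\Psi(v)w$ on a compact product of balls replaces an explicit
    estimate. *)
Lemma bounded_mul_Psi : exists M, forall z, OmegaT z ->
  `|Psi X z.1.2 *m z.1.1.1| <= M.
Proof.
have [Mw wM] := bounded_w; have [Mv vM] := bounded_v.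
pose F (q : 'cV[R]_(dim_w L Nd) * 'cV[R]_(dim_v L N Nd)) := Psi X q.2 *m q.1.
have Fc : continuous F.
  by apply: continuous_mul_Psi => q; [exact: cvg_snd|exact: cvg_fst].
have K := compact_setX (@proper_cV R (dim_w L Nd) Mw)
  (@proper_cV R (dim_v L N Nd) Mv).
have /bounded_setP[M FM] :=
  compact_bounded (continuous_compact (continuous_subspaceT Fc) K).
exists M => z zT; apply: FM; exists (z.1.1.1, z.1.2) => //.
by split; [exact: wM|exact: vM].
Qed.

(** Since $b$ enters only through $Ab = u - \Psi(v)w$, its bound comes last; the
    first data point serves to read off the coordinates of $b$ from $Ab$. *)
Lemma bounded_b : exists M, forall z, OmegaT z -> `|z.1.1.2| <= M.
Proof.
have [Mu uM] := bounded_u; have [MP PM] := bounded_mul_Psi.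
apply: bounded_cV => i; exists (Mu + MP) => -[[[w b] v] u] zT /=.
have [[_ _ uE] _] := zT.
have -> : b i 0 = submxcol (Amat R L N Nd *m b) (tagnat.sig1 i)
    (mxtens_index (Ordinal N_gt0, tagnat.sig2 i)) 0.
  by rewrite mul_Amat_entry mxE tagnat.sig2K.
rewrite mxE (le_trans (coord_le_mx_norm _ _ _))//.
have -> : Amat R L N Nd *m b = u - Psi X v *m w by rewrite uE addrC addKr.
by rewrite (le_trans (ler_normB _ _))// lerD ?(uM _ zT) ?(PM _ zT).
Qed.

Lemma bounded_Omega_theta : bounded_set OmegaT.
Proof.
have [Mw wM] := bounded_w; have [Mb bM] := bounded_b.
have [Mv vM] := bounded_v; have [Mu uM] := bounded_u.
apply/bounded_setP; exists (Num.max (Num.max (Num.max Mw Mb) Mv) Mu) => z zT.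
by rewrite !prod_normE/= !ge_max !le_max wM// bM// vM// uM// !orbT.
Qed.

Lemma closed_Omega_theta : closed OmegaT.
Proof.
pose F (z : vars R L N Nd) := Psi X z.1.2 *m z.1.1.1 + Amat R L N Nd *m z.1.1.2.
have Fc : continuous F.
  apply: continuous_addmx.
    exact: (continuous_mul_Psi
              (@continuous_v R L N Nd) (@continuous_w R L N Nd)).
  apply: continuous_mulmx => [t|]; first exact: cst_continuous.
  exact: (@continuous_b R L N Nd).
(* Equality in the layer equations is a pair of weak inequalities. *)
have -> : OmegaT =
    ([set z : vars R L N Nd | forall i, z.2 i 0 <= z.1.2 i 0] `&`
     [set z : vars R L N Nd | forall i, alpha * z.2 i 0 <= z.1.2 i 0] `&`
     ([set z : vars R L N Nd | forall i, z.2 i 0 <= F z i 0] `&`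
      [set z : vars R L N Nd | forall i, F z i 0 <= z.2 i 0])) `&`
    [set z : vars R L N Nd |
      obj X Y alpha lambda_w lambda_v beta z.1.1.1 z.1.2 z.2 <= theta].
  apply/seteqP; split => -[[[w b] v] u] /=.
    move=> [z2 le_theta]; have [_ _ uE] := z2.
    split => //; split; last by rewrite /F/= -uE.
    by split=> i; have [] := Omega2_feasible z2 i.
  move=> [[[vu avu] [uF Fu]] le_theta]; split=> //; split=> [i|i|].
  - by rewrite !mxE subr_ge0.
  - by rewrite !mxE subr_ge0.
  - by apply/colP => i; apply/le_anti; rewrite uF Fu.
have vc i : continuous (fun z : vars R L N Nd => z.1.2 i 0).
  exact: (continuous_entry (@continuous_v R L N Nd)).
have uc i : continuous (fun z : vars R L N Nd => z.2 i 0).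
  exact: (continuous_entry (@continuous_u R L N Nd)).
have Fic i : continuous (fun z => F z i 0) by exact: continuous_entry Fc.
apply: closedI; first apply: closedI; first apply: closedI.
- by apply: closed_forall => i; exact: closed_le_fun.
- apply: closed_forall => i; apply: closed_le_fun => //.
  by apply: continuous_mulr => [t|//]; exact: cst_continuous.
- by apply: closedI; apply: closed_forall => i; exact: closed_le_fun.
- apply: closed_le_fun => [|t]; last exact: cst_continuous.
  exact: (continuous_obj (@continuous_w R L N Nd) (@continuous_v R L N Nd)
                         (@continuous_u R L N Nd)).
Qed.

Lemma compact_Omega_theta : compact OmegaT.
Proof.
apply: bounded_closed_compact_proper.
- by do 3![apply: proper_prod; last exact: proper_cV]; exact: proper_cV.
- exact: bounded_Omega_theta.
- exact: closed_Omega_theta.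
Qed.

End SublevelBounds.

(** * The zero network *)

Section ZeroNetwork.
Context {R : realType} {L N : nat} {Nd : nat -> nat}.
Context {X : 'M[R]_(Nd 0%N, N)} {Y : 'M[R]_(Nd L, N)}.

Lemma Omega2_0 alpha : @Omega2 R L N Nd X alpha (0, 0, 0, 0).
Proof.
split=> [i|i|]; rewrite ?scaler0 ?subrr ?mxE//.
by rewrite !mulmx0 addr0.
Qed.

Lemma unvec0 p q : unvec (0 : 'cV[R]_(q * p)) = 0.
Proof. by apply/matrixP => i j; rewrite !mxE. Qed.

(** Only $V_0$ is fixed by the data; all later states vanish with $v$. *)
Lemma state0 l : (0 < l)%N -> state X (0 : 'cV[R]_(dim_v L N Nd)) l = 0.
Proof.
by case: l => // k _ /=; case: decP => // kL; rewrite submxcol0 unvec0.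
Qed.

Lemma R1_0 lambda_w : R1 lambda_w (0 : 'cV[R]_(dim_w L Nd)) = 0.
Proof.
rewrite /R1 big1 ?mulr0// => l _; rewrite big1// => j _.
by rewrite /weight submxcol0 unvec0 col0 fnorm0.
Qed.

Lemma sigma0 alpha p : sigma alpha (0 : 'cV[R]_p) = 0.
Proof. by apply/colP => i; rewrite !mxE mulr0 maxxx. Qed.

(** With $L > 0$ the output $V_L$ is a block of $v$, hence zero, and only the
    loss of the zero output remains. *)
Lemma obj_0 alpha lambda_w lambda_v beta : (0 < L)%N ->
  obj X Y alpha lambda_w lambda_v beta 0 0 0 = N%:R^-1 * fnorm Y ^+ 2.
Proof.
move=> L_gt0; rewrite /obj /obj_bar R1_0 /R2 fnorm0 expr0n mulr0 sigma0 subrr.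
rewrite mulmx0 mxE !addr0; congr (_ * _).
rewrite -sqr_fnorm_col; apply: eq_bigr => n _.
by rewrite state0// col0 sub0r fnormN.
Qed.

End ZeroNetwork.

Theorem theorem8 (R : realType) (L N : nat) (Nd : nat -> nat)
  (L_gt0 : (0 < L)%N) (N_gt0 : (0 < N)%N)
  (Nd_gt0 : forall l : nat, (l <= L)%N -> (0 < Nd l)%N)
  (X : 'M[R]_(Nd 0%N, N)) (Y : 'M[R]_(Nd L, N))
  (alpha lambda_w lambda_v : R) (beta : 'I_L -> R) (theta : R)
  (alpha_gt0 : 0 < alpha) (alpha_lt1 : alpha < 1)
  (lambda_w_gt0 : 0 < lambda_w) (lambda_v_gt0 : 0 < lambda_v)
  (beta_gt0 : forall l : 'I_L, 0 < beta l)
  (theta_gt : N%:R^-1 * fnorm Y ^+ 2 < theta) :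
  bounded_set (Omega_theta X Y alpha lambda_w lambda_v beta theta) /\
  PP_solutions X Y alpha lambda_w lambda_v beta !=set0 /\
  bounded_set (PP_solutions X Y alpha lambda_w lambda_v beta).
Proof.
set OmegaT := Omega_theta X Y alpha lambda_w lambda_v beta theta.
have bT : bounded_set OmegaT by exact: bounded_Omega_theta.
have cT : compact OmegaT by exact: compact_Omega_theta.
have T0 : OmegaT (0, 0, 0, 0).
  by split; [exact: Omega2_0|rewrite obj_0// ltW].
pose f (z : vars R L N Nd) :=
  obj X Y alpha lambda_w lambda_v beta z.1.1.1 z.1.2 z.2.
have fc : continuous f.
  exact: (continuous_obj (@continuous_w R L N Nd) (@continuous_v R L N Nd)
                         (@continuous_u R L N Nd)).
split=> //; split.
  have [|z /[!inE] zT zmin] := compact_EVT_min _ cT (continuous_subspaceT fc).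
    by exists (0, 0, 0, 0).
  exists z; split; first by case: zT.
  move=> z' z'2; have : f z <= f z'; last first.
    by case: (z) => [[[? ?] ?] ?]; case: (z') => [[[? ?] ?] ?].
  (* A feasible point outside the sublevel set is worse than [theta]. *)
  have [fz'|/ltW] := leP (f z') theta.
    apply: zmin; rewrite inE; split=> //.
    by case: z' z'2 fz' => [[[? ?] ?] ?].
  apply: le_trans; case: zT => _.
  by case: (z) => [[[? ?] ?] ?].
have /bounded_setP[M TM] := bT.
apply/bounded_setP; exists M => z [z2 zmin]; apply: TM; split=> //.
(* A solution does at least as well as the zero network. *)
have := zmin (0, 0, 0, 0) (Omega2_0 alpha).
case: (z) => [[[w b] v] u] /le_trans; apply.
by rewrite obj_0// ltW.
Qed.
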